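(* An ultrametrizable topological space $(X,\mathcal{O})$ is separable if and only if every pruned tree that represents it is countable.
   Context: $\mathbb{N}=\{0,1,2,\dots\}$. An ultrametric on $X$ is a metric $d$ with $d(x,y)\le\max\{d(x,z),d(z,y)\}$ for all $x,y,z$; a topological space is ultrametrizable if some ultrametric induces its topology. A set $A\subset[0,\infty)$ is sequentially-descending-to-zero if there is a sequence $(a_k)_{k\in\mathbb{N}}$ of non-negative reals converging to $0$ with $A=\{0\}\cup\{a_k: k\in\mathbb{N}\}$. A metric $d$ is sequentially-descending-to-zero if its image $\operatorname{im} d$ is such a set. Closed balls are $\overline{B}(x,r)=\{y\in X: d(x,y)\le r\}$, $r\ge 0$ (so $\overline{B}(x,0)=\{x\}$). Let $(X,d)$ be a sequentially-descending-to-zero ultrametric space, and let $(r_k)_{k\in\mathbb{N}}$ be the weakly decreasing sequence of non-negative reals such that $\operatorname{im} d=\{0\}\cup\{r_k:k\in\mathbb{N}\}$ and, for every $k$, if $r_k>0$ then $r_k>r_{k+1}$. The tree representing $(X,d)$ is the following set of finite sequences of closed balls: $$T_{(X,d)}=\{\emptyset\}\cup\left\{\left(\overline{B}(x,r_j)\right)_{j=1}^{k}: x\in X,\ k\in\mathbb{N}\setminus\{0\}\right\}.$$ It is a pruned tree (a non-empty prefix-closed set of finite sequences in which every element is a strict prefix of another element). A tree represents the ultrametrizable space $(X,\mathcal{O})$ if it equals $T_{(X,d)}$ for some sequentially-descending-to-zero ultrametric $d$ on $X$ inducing $\mathcal{O}$. *)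

(* Defs.v *)
From HB Require Import structures.
From mathcomp Require Import all_boot all_order all_algebra.
From mathcomp Require Import all_classical all_reals all_analysis.
Set Implicit Arguments.
Unset Strict Implicit.
Unset Printing Implicit Defensive.
Import Order.TTheory GRing.Theory Num.Theory.
Import numFieldTopology.Exports.
Local Open Scope classical_set_scope.
Local Open Scope ring_scope.

Record is_metric (R : realType) (X : Type) (d : X -> X -> R) : Prop := {
  is_metric_ge0 : forall x y, 0 <= d x y ;
  is_metric_eq0 : forall x y, d x y = 0 <-> x = y ;
  is_metric_sym : forall x y, d x y = d y x ;
  is_metric_triangle : forall x y z, d x y <= d x z + d z y }.

Definition is_ultrametric (R : realType) (X : Type) (d : X -> X -> R) : Prop :=
  is_metric d /\ forall x y z, d x y <= Num.max (d x z) (d z y).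

Definition induces_topology (R : realType) (X : topologicalType)
    (d : X -> X -> R) : Prop :=
  forall A : set X, open A <->
    forall x, A x -> exists2 e : R, 0 < e & [set y | d x y < e] `<=` A.

Definition ultrametrizable (R : realType) (X : topologicalType) : Prop :=
  exists d : X -> X -> R, is_ultrametric d /\ induces_topology d.

Definition separable (X : topologicalType) : Prop :=
  exists D : set X, countable D /\ dense D.

Definition metric_image (R : realType) (X : Type) (d : X -> X -> R) : set R :=
  [set d x y | x in [set: X] & y in [set: X]].

Definition seq_desc_to_zero (R : realType) (A : set R) : Prop :=
  exists a : nat -> R,
    [/\ forall k, 0 <= a k, a @ \oo --> (0 : R) & A = [set 0] `|` range a].

Definition metric_closed_ball (R : realType) (X : Type) (d : X -> X -> R)
  (x : X) (r : R) : set X := [set y | d x y <= r].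

(* At most one sequence r satisfies this for a given d, and one does when
   the image of d is sequentially-descending-to-zero.  If the image is finite,
   r is eventually 0. *)
Definition radius_sequence (R : realType) (X : Type) (d : X -> X -> R)
    (r : nat -> R) : Prop :=
  [/\ forall k, 0 <= r k,
      forall k, r k.+1 <= r k,
      metric_image d = [set 0] `|` range r &
      forall k, 0 < r k -> r k.+1 < r k].

(* The balls of radius r 0 are skipped: each of them is all of X, which is
   already accounted for by the empty sequence. *)
Definition ball_tree (R : realType) (X : Type) (d : X -> X -> R)
    (r : nat -> R) : set (seq (set X)) :=
  [set [::]] `|`
  [set s | exists (x : X) (k : nat), (0 < k)%N /\
     s = [seq metric_closed_ball d x (r j) | j <- iota 1 k]].

Definition pruned_tree (A : Type) (T : set (seq A)) : Prop :=
  [/\ T !=set0,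
      forall s t, T (s ++ t) -> T s &
      forall s, T s -> exists2 u, u <> [::] & T (s ++ u)].

Definition represents (R : realType) (X : topologicalType)
    (T : set (seq (set X))) : Prop :=
  exists (d : X -> X -> R) (r : nat -> R),
    [/\ is_ultrametric d, induces_topology d,
        seq_desc_to_zero (metric_image d),
        radius_sequence d r & T = ball_tree d r].

(* Main.v *)
Require Import Defs.
From HB Require Import structures.
From mathcomp Require Import all_boot all_order all_algebra.
From mathcomp Require Import all_classical all_reals all_analysis.

(** If [X] is separable, every ball of positive radius meets the countable dense
    set [D], and in an ultrametric space a ball is determined by any one of its
    points.  So a node of the tree is determined by its length and a point of
    [D], and there are countably many nodes.  A level [k] with [r k = 0] is no
    exception: the image of [d] is then finite, so that [X] is discrete, every
    singleton is open and [D] is all of [X].  Both cases are covered by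
    [closed_ball_uniform_nbhs].

    Conversely, if the tree is countable, pick a point in the last ball of each
    node; since the radii tend to [0], the chosen points are dense.  What has to
    be proved is that there is a tree to which this applies: every ultrametrizable
    space carries an ultrametric whose image descends to zero and whose positive
    values are enumerated by a radius sequence ([ultrametrizable_descending]).
    Starting from any ultrametric [d], apply to its values a function [g] that
    is nondecreasing and vanishes exactly at [0], which keeps it an ultrametric.
    The function [g] first discretizes [t > 0] to the integer part [n] of [1/t],
    then replaces [n] by its rank [c n], the number of smaller integer parts that
    [d] realizes, and returns [1 / (c n + 1)].  Taking ranks closes the gaps: the
    positive values of the new metric are an initial segment of [1, 1/2, 1/3, ...],
    so that [r k] is [1 / (k + 1)] as long as rank [k] occurs, and [0]
    afterwards. *)

Set Implicit Arguments.
Unset Strict Implicit.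
Unset Printing Implicit Defensive.
Import Order.TTheory GRing.Theory Num.Theory.
Import numFieldNormedType.Exports.
Local Open Scope classical_set_scope.
Local Open Scope ring_scope.

(** * Rank in a set of natural numbers *)

Definition nat_rank (S : set nat) (n : nat) : nat := count (mem S) (iota 0 n).

Lemma nat_rankS S n : nat_rank S n.+1 = (nat_rank S n + (n \in S))%N.
Proof. by rewrite /nat_rank -addn1 iotaD count_cat /= addn0. Qed.

Lemma nat_rank_mono S m n : (m <= n)%N -> (nat_rank S m <= nat_rank S n)%N.
Proof. by move=> /subnKC <-; rewrite /nat_rank iotaD count_cat leq_addr. Qed.

Lemma nat_rank_attained_pred S n k :
  nat_rank S n = k.+1 -> exists2 m, S m & nat_rank S m = k.
Proof.
elim: n => [//|n IHn]; rewrite nat_rankS.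
have [Sn|nSn] := boolP (n \in S); last by rewrite addn0.
by rewrite addn1 => -[nk]; exists n => //; exact: set_mem.
Qed.

(** When [S] is finite and [k] exceeds its cardinality, the bound [N] is past the
    last element of [S] and the statement is vacuous. *)
Lemma nat_rank_unbounded S k :
  exists N, forall n, S n -> (N <= n)%N -> (k <= nat_rank S n)%N.
Proof.
elim: k => [|k [N HN]]; first by exists 0%N.
have [[m Sm Nm]|noS] := pselect (exists2 m, S m & (N <= m)%N).
  exists m.+1 => n _ mn.
  apply: leq_trans (nat_rank_mono S mn).
  by rewrite nat_rankS mem_set // addn1 ltnS HN.
by exists N => n Sn Nn; case: noS; exists n.
Qed.

(** * Making the image of an ultrametric descend to zero *)

Definition rank_gauge (R : realType) (S : set nat) (t : R) : R :=
  if t == 0 then 0 else harmonic (nat_rank S (Num.truncn t^-1)).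

Lemma ler_harmonic (R : realType) m n :
  (harmonic m <= harmonic n :> R) = (n <= m)%N.
Proof. by rewrite /harmonic /= lef_pV2 ?posrE ?ltr0n // ler_nat ltnS. Qed.

Lemma rank_gauge_ge0 (R : realType) S (t : R) : 0 <= rank_gauge S t.
Proof. by rewrite /rank_gauge; case: eqP => // _; exact: harmonic_ge0. Qed.

Lemma rank_gauge_eq0 (R : realType) S (t : R) : rank_gauge S t = 0 <-> t = 0.
Proof.
rewrite /rank_gauge; case: eqP => // nt; split=> // /eqP.
by rewrite gt_eqF // harmonic_gt0.
Qed.

Lemma rank_gauge_mono (R : realType) S (s t : R) :
  0 <= s -> s <= t -> rank_gauge S s <= rank_gauge S t.
Proof.
rewrite le_eqVlt => /predU1P[<- _|s0 st].
  by rewrite {1}/rank_gauge eqxx rank_gauge_ge0.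
have t0 := lt_le_trans s0 st.
rewrite /rank_gauge !gt_eqF // ler_harmonic; apply: nat_rank_mono.
by apply: le_truncn; rewrite lef_pV2.
Qed.

Definition dist_levels (R : realType) (X : Type) (d : X -> X -> R) : set nat :=
  [set Num.truncn t^-1 | t in metric_image d `&` [set t | t != 0]].

(** A nondecreasing [g] commutes with [max], so the strong triangle inequality is
    preserved where the additive one would require [g] to be subadditive. *)
Lemma ultrametric_comp (R : realType) (X : Type) (d : X -> X -> R) (g : R -> R) :
  is_ultrametric d -> (forall t, 0 <= g t) -> (forall t, g t = 0 <-> t = 0) ->
  (forall s t, 0 <= s -> s <= t -> g s <= g t) ->
  is_ultrametric (fun x y => g (d x y)).
Proof.
move=> [dm du] g_ge0 g_eq0 g_mono.
have gu x y z : g (d x y) <= Num.max (g (d x z)) (g (d z y)).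
  have := du x y z; rewrite !le_max => /orP[] /g_mono -> //.
  - exact: is_metric_ge0.
  - by rewrite orbT.
  - exact: is_metric_ge0.
split=> //; split=> //.
- by move=> x y; rewrite g_eq0; exact: is_metric_eq0.
- by move=> x y; rewrite (is_metric_sym dm).
- move=> x y z; apply: le_trans (gu x y z) _.
  by rewrite ge_max lerDl lerDr !g_ge0.
Qed.

Lemma induces_topology_equiv (R : realType) (X : topologicalType)
    (d d' : X -> X -> R) :
  induces_topology d ->
  (forall e, 0 < e ->
     exists2 e', 0 < e' & forall x y, d' x y < e' -> d x y < e) ->
  (forall e, 0 < e ->
     exists2 e', 0 < e' & forall x y, d x y < e' -> d' x y < e) ->
  induces_topology d'.
Proof.
move=> dX dd' d'd A; rewrite dX; split=> Ao x /Ao[e e0 eA].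
  have [e' e'0 e'e] := dd' e e0; exists e' => // y /= ye; exact/eA/e'e.
have [e' e'0 e'e] := d'd e e0; exists e' => // y /= ye; exact/eA/e'e.
Qed.

Lemma exists_harmonic_lt (R : realType) (e : R) :
  0 < e -> exists N, harmonic N < e.
Proof.
move=> e0.
have [N _ /(_ N (leqnn N))] : \forall k \near \oo, harmonic k < e.
  by apply: cvgr_lt e0; exact: cvg_harmonic.
by exists N.
Qed.

(** The metric keeps its uniformity, hence its topology, because on the realized
    levels both discretization and rank go to infinity exactly when the distance
    goes to [0]. *)
Lemma rank_gauge_topology (R : realType) (X : topologicalType)
    (d : X -> X -> R) :
  is_metric d -> induces_topology d ->
  induces_topology (fun x y => rank_gauge (dist_levels d) (d x y)).
Proof.
move=> dm dX; set S := dist_levels d.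
have level_lt N (t : R) : 0 < t -> (N < Num.truncn t^-1)%N -> t <= harmonic N.
  move=> t0; rewrite truncn_gt_nat => Nt.
  by rewrite /harmonic /= -[t]invrK lef_pV2 ?posrE ?invr_gt0 ?ltr0n.
apply: (induces_topology_equiv dX) => e e0.
  have [N Ne] := exists_harmonic_lt e0.
  exists (harmonic (nat_rank S N)) => [|x y]; first exact: harmonic_gt0.
  rewrite /rank_gauge; case: eqP => [-> //|/eqP dxy].
  rewrite ltNge ler_harmonic -ltnNge => rk.
  apply: le_lt_trans Ne; apply: level_lt.
    by rewrite lt_neqAle eq_sym dxy (is_metric_ge0 dm).
  by rewrite ltnNge; apply: contraL rk => /(nat_rank_mono S); rewrite -leqNgt.
have [k ke] := exists_harmonic_lt e0.
have [N HN] := nat_rank_unbounded S k.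
exists (harmonic N) => [|x y dN]; first exact: harmonic_gt0.
rewrite /rank_gauge; case: eqP => [//|/eqP dxy].
apply: le_lt_trans ke; rewrite ler_harmonic; apply: HN.
  by exists (d x y) => //; split=> //; exists x => //; exists y.
have dgt0 : 0 < d x y by rewrite lt_neqAle eq_sym dxy (is_metric_ge0 dm).
rewrite truncn_ge_nat; last by rewrite invr_ge0 ltW.
apply: (@le_trans _ _ N.+1%:R); first by rewrite ler_nat.
by rewrite -[N.+1%:R]invrK lef_pV2 ?posrE ?invr_gt0 ?ltr0n // ltW.
Qed.

Definition rank_radius (R : realType) (S : set nat) (k : nat) : R :=
  if `[< exists2 n, S n & nat_rank S n = k >] then harmonic k else 0.

Lemma rank_radius_ge0 (R : realType) S k : 0 <= rank_radius R S k.
Proof. by rewrite /rank_radius; case: ifP => // _; exact: harmonic_ge0. Qed.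

Lemma rank_radius_cvg0 (R : realType) S : rank_radius R S @ \oo --> (0 : R).
Proof.
apply: (@squeeze_cvgr _ _ _ _ (fun=> 0) harmonic).
- apply: nearW => k; rewrite rank_radius_ge0 /= /rank_radius.
  by case: ifP => // _; exact: harmonic_ge0.
- exact: cvg_cst.
- exact: cvg_harmonic.
Qed.

Lemma rank_radius_sequence (R : realType) (X : Type) (x0 : X)
    (d : X -> X -> R) :
  is_metric d ->
  radius_sequence (fun x y => rank_gauge (dist_levels d) (d x y))
    (rank_radius R (dist_levels d)).
Proof.
move=> dm; set S := dist_levels d.
(* Ranks leave no gap, so once [r] vanishes it stays zero. *)
have noskip k : (exists2 n, S n & nat_rank S n = k.+1) ->
    exists2 n, S n & nat_rank S n = k.
  by move=> [n _]; exact: nat_rank_attained_pred.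
split.
- exact: rank_radius_ge0.
- move=> k; rewrite {1}/rank_radius; case: asboolP => [/noskip h|_].
    by rewrite /rank_radius asboolT // ler_harmonic.
  exact: rank_radius_ge0.
- apply/seteqP; split=> t.
    move=> [x _ [y _ <-]]; rewrite /rank_gauge.
    case: eqP => [_|/eqP dxy]; [by left | right].
    exists (nat_rank S (Num.truncn (d x y)^-1)) => //.
    rewrite /rank_radius asboolT //; exists (Num.truncn (d x y)^-1) => //.
    by exists (d x y) => //; split=> //; exists x => //; exists y.
  have image0 : metric_image (fun x y => rank_gauge S (d x y)) 0.
    exists x0 => //; exists x0 => //.
    by apply/rank_gauge_eq0; exact/(is_metric_eq0 dm).
  move=> [-> //|[k _ <-]]; rewrite /rank_radius; case: asboolP => // -[n Sn <-].
  case: Sn => _ [[x _ [y _ <-]] /= dxy] <-.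
  by exists x => //; exists y => //; rewrite /rank_gauge (negbTE dxy).
- move=> k; rewrite {1}/rank_radius; case: asboolP => [h _|]; last by rewrite ltxx.
  rewrite {2}/rank_radius asboolT // /rank_radius.
  case: asboolP => _; last exact: harmonic_gt0.
  by rewrite ltNge ler_harmonic ltnn.
Qed.

Lemma ultrametrizable_descending (R : realType) (X : topologicalType) (x0 : X) :
  ultrametrizable R X ->
  exists (d : X -> X -> R) (r : nat -> R),
    [/\ is_ultrametric d, induces_topology d, seq_desc_to_zero (metric_image d),
        radius_sequence d r & r @ \oo --> (0 : R)].
Proof.
move=> [d [du dX]]; have dm := du.1.
have dr := rank_radius_sequence x0 dm.
exists (fun x y => rank_gauge (dist_levels d) (d x y)).
exists (rank_radius R (dist_levels d)); split=> //.
- apply: ultrametric_comp => //.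
  + exact: rank_gauge_ge0.
  + exact: rank_gauge_eq0.
  + exact: rank_gauge_mono.
- exact: rank_gauge_topology.
- exists (rank_radius R (dist_levels d)); split.
  + exact: rank_radius_ge0.
  + exact: rank_radius_cvg0.
  + by case: dr.
- exact: rank_radius_cvg0.
Qed.

(** * The tree of balls *)

Lemma ball_tree_pruned (R : realType) (X : Type) (x0 : X)
    (d : X -> X -> R) (r : nat -> R) : pruned_tree (ball_tree d r).
Proof.
split; first by exists [::]; left.
- move=> s t; case: s => [|B s]; first by left.
  move=> [//|[x [k [k0 skE]]]]; right; exists x, (size s).+1; split=> //.
  have sk : ((size s).+1 <= k)%N.
    by rewrite -(size_iota 1 k) -(size_map (fun j => metric_closed_ball d x (r j)))
      -skE size_cat leq_addr.
  have -> : B :: s = take (size s).+1 ((B :: s) ++ t) by rewrite take_size_cat.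
  by rewrite skE -map_take take_iota (minn_idPl sk).
- move=> s [->|[x [k [k0 ->]]]].
    exists [:: metric_closed_ball d x0 (r 1%N)] => //.
    by right; exists x0, 1%N.
  exists [:: metric_closed_ball d x (r k.+1)] => //.
  right; exists x, k.+1; split=> //.
  by rewrite -(addn1 k) iotaD map_cat /= add1n addn1.
Qed.

(** At a positive radius [r k], take [e = r k] to get the next level: no distance
    lies strictly between [r k.+1] and [r k].  Once [r k = 0], all later radii
    are [0] as well and the same [e] serves for them. *)
Lemma closed_ball_uniform_nbhs (R : realType) (X : Type)
    (d : X -> X -> R) (r : nat -> R) : radius_sequence d r ->
  forall k, exists2 e, 0 < e & forall x y, d x y < e -> d x y <= r k.
Proof.
move=> [r0 rS dE rlt].
have /nonincreasing_seqP rmono := rS.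
have dP x y : d x y = 0 \/ exists j, r j = d x y.
  have : metric_image d (d x y) by exists x => //; exists y.
  by rewrite dE => -[->|[j _ <-]]; [left | right; exists j].
elim=> [|k [e e0 IH]].
  exists 1 => // x y _; have [->|[j <-]] := dP x y; first exact: r0.
  exact: rmono.
have [rk|rk] := ltP 0 (r k).
  exists (r k) => // x y; have [-> //|[j <-]] := dP x y.
  have [kj _|jk] := ltnP k j; first exact: rmono.
  by rewrite ltNge rmono.
by exists e => // x y /IH dk; exact: le_trans dk (le_trans rk (r0 _)).
Qed.

Lemma ultrametric_closed_ball_eq (R : realType) (X : Type) (d : X -> X -> R)
    (x y : X) (t : R) :
  is_ultrametric d -> d x y <= t ->
  metric_closed_ball d x t = metric_closed_ball d y t.
Proof.
move=> [dm du] xy; apply/seteqP; split=> z /= h.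
  by apply: le_trans (du y z x) _; rewrite ge_max (is_metric_sym dm) xy.
by apply: le_trans (du x z y) _; rewrite ge_max xy.
Qed.

Lemma ultrametric_closed_ball_open (R : realType) (X : topologicalType)
    (d : X -> X -> R) (r : nat -> R) (x : X) (k : nat) :
  is_ultrametric d -> induces_topology d -> radius_sequence d r ->
  open (metric_closed_ball d x (r k)).
Proof.
move=> du dX dr; apply/dX => y xy.
have [e e0 He] := closed_ball_uniform_nbhs dr k.
exists e => // z /= /He yz.
by rewrite (ultrametric_closed_ball_eq du xy).
Qed.

(** In an ultrametric space a point [y] of the last and smallest ball of a node
    lies in all its balls and is a center of each, so the node can be recentered
    at a point of the dense set. *)
Lemma separable_countable_ball_tree (R : realType) (X : topologicalType)
    (d : X -> X -> R) (r : nat -> R) :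
  is_ultrametric d -> induces_topology d -> radius_sequence d r ->
  separable X -> countable (ball_tree d r).
Proof.
move=> du dX dr [D [Dc Dd]].
have dm := du.1.
pose node (p : X * nat) :=
  [seq metric_closed_ball d p.1 (r j) | j <- iota 1 p.2].
have nodes_countable : countable (node @` (D `*` [set: nat])).
  apply: sub_countable (card_image_le _ _) _.
  by apply: countableX => //; exact: countableP.
apply: (@sub_countable _ _ _ ([set [::]] `|` node @` (D `*` [set: nat]))).
  apply: subset_card_le => s [->|[x [k [k0 ->]]]]; [by left | right].
  have [||y [xy Dy]] := Dd (metric_closed_ball d x (r k)).
  - exists x; rewrite /metric_closed_ball /=.
    by rewrite (iffRL (is_metric_eq0 dm x x) erefl); case: dr.
  - exact: (ultrametric_closed_ball_open x k du dX dr).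
  exists (y, k) => //; apply/eq_in_map => j; rewrite mem_iota add1n ltnS.
  move=> /andP[_ jk]; apply/esym/ultrametric_closed_ball_eq => //.
  apply: le_trans xy _; case: dr => _ /nonincreasing_seqP rmono _ _.
  exact: rmono.
rewrite -bigcup2E; apply: bigcup_countable; first exact: countableP.
by case=> [|[|?]] _; [exact: countable1 | | exact: countable0].
Qed.

Lemma countable_ball_tree_separable (R : realType) (X : topologicalType) (x0 : X)
    (d : X -> X -> R) (r : nat -> R) :
  is_metric d -> induces_topology d ->
  (forall k, 0 <= r k) -> r @ \oo --> (0 : R) ->
  countable (ball_tree d r) -> separable X.
Proof.
move=> dm dX r0 rcvg Tc.
pose pt (s : seq (set X)) := xget x0 (last setT s).
exists (pt @` ball_tree d r); split.
  exact: sub_countable (card_image_le _ _) Tc.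
move=> A [x Ax] /dX /(_ x Ax)[e e0 eA].
have [N _ /(_ N.+1 (leqnSn N)) /= rNe] : \forall k \near \oo, r k < e.
  by apply: cvgr_lt e0; exact: rcvg.
(* Length [N.+1] rather than [N]: the node must be non-empty to have a last ball. *)
pose s := [seq metric_closed_ball d x (r j) | j <- iota 1 N.+1].
have last_s : last setT s = metric_closed_ball d x (r N.+1).
  by rewrite /s -[in iota _ _](addn1 N) iotaD map_cat last_cat.
exists (pt s); split; last by exists s => //; right; exists x, N.+1.
apply: eA => /=; apply: le_lt_trans rNe.
rewrite /pt last_s; apply: (@xgetPex _ x0 (metric_closed_ball d x (r N.+1))).
exists x.
by rewrite /metric_closed_ball /= (iffRL (is_metric_eq0 dm x x) erefl).
Qed.

Theorem corollary4p18 (R : realType) (X : topologicalType)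
    (hX : ultrametrizable R X) :
  separable X <->
  (forall T : set (seq (set X)), pruned_tree T -> represents R T -> countable T).
Proof.
split=> [sX T _ [d [r [du dX _ dr ->]]]|cT].
  exact: separable_countable_ball_tree.
(* On the empty space no tree represents [X], since the image of a metric with a
   radius sequence contains [0]; separability then holds for free. *)
have [[x0 _]|X0] := pselect ([set: X] !=set0); last first.
  exists set0; split; first exact: countable0.
  by move=> A [x _]; case: X0; exists x.
have [d [r [du dX dz dr rcvg]]] := ultrametrizable_descending x0 hX.
apply: (countable_ball_tree_separable x0 du.1 dX _ rcvg); first by case: dr.
by apply: cT; [exact: ball_tree_pruned | exists d, r].
Qed.
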